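(* Let $(\mathbf e^{(p)})_{p\ge0}$ be a sequence produced by the NSMM algorithm, i.e. $\mathbf e^{(0)}$ satisfies assumptions (ii) and (vi) of the context and $\mathbf e^{(p+1)}=G(\mathbf e^{(p)})$ for all $p\ge0$. Then at any step $p$, $$l(\mathbf e^{(p)})-l(\mathbf e^{(p+1)})\ \ge\ \sum_{j=1}^mKL\bigl(e_j^{(p+1)},e_j^{(p)}\bigr).$$ The same holds for the discrete version of the algorithm, with $G$ and $l$ replaced by $G_{\mathrm{discrete}}$ and $l_{\mathrm{discrete}}$.
   Context: Setting. $\Omega=[a,b]^r\subset\mathbb R^r$ with $a<b$; $g$ is a probability density on $\mathbb R^r$ (the target) with support in the interior of $\Omega$; $h\in\mathbb R$ is a given bandwidth; $s_h\in L^1(\mathbb R\times\mathbb R)$ is nonnegative with support in $[a,b]\times[a,b]$. In the discrete version, $\mathbf x_1,\dots,\mathbf x_n$ is a random sample of size $n$, whose empirical distribution replaces $g(\mathbf x)\,d\mathbf x$. Assumptions. (i) The number $m$ of mixing components in $g$ is fixed, and there exist nonnegative functions $e_1,\dots,e_m$ with $g(\mathbf x)=\sum_{j=1}^m e_j(\mathbf x)$. (ii) For each $1\le j\le m$, $e_j(\mathbf x)=\theta_j\prod_{k=1}^r e_{j,k}(x_k)$, where $\theta_j>0$ and each $e_{j,k}\in L^1(\mathbb R)$ is positive with support in $[a,b]$. (iii) $\int s_h(v,u)\,du=\int s_h(u,z)\,du=1$ for $v,z\in[a,b]$. (iv) There are positive numbers $M_1(h)$ and $M_2$ with $M_1(h)\le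 s_h(v,z)\le M_2$ for all $v,z\in[a,b]$. (v) $s_h$ has continuous first-order partial derivatives on $(a,b)\times(a,b)$, both bounded there in absolute value by a constant $B$. (vi) With $f_j(\mathbf x)=e_j(\mathbf x)/\int e_j(\mathbf z)\,d\mathbf z$, one has $f_j(\mathbf x)\ge(M_1(h))^r$ for all $\mathbf x\in\Omega$ and each $j$. Candidates. The $m$-tuple $\mathbf e=(e_1,\dots,e_m)$ is the unknown to be estimated. The only assumptions that impose constraints on a candidate $\mathbf e$ are (ii) and (vi); in particular it is not required that $\sum_je_j$ be a density. Smoothing. $\tilde s_h(\mathbf x,\mathbf u)=\prod_{k=1}^r s_h(x_k,u_k)$; $(S_h^*f)(\mathbf x)=\int\tilde s_h(\mathbf u,\mathbf x)f(\mathbf u)\,d\mathbf u$; $(\mathcal N_hf)(\mathbf x)=\exp[(S_h^*\log f)(\mathbf x)]$ for $\mathbf x\in\Omega$ and $0$ elsewhere (integrals against $\tilde s_h$ are effectively over $\Omega$). Objectives. $l(\mathbf e)=\int g(\mathbf x)\log\dfrac{g(\mathbf x)}{\sum_{j=1}^m(\mathcal N_he_j)(\mathbf x)}\,d\mathbf x+\int\sum_{j=1}^m e_j(\mathbf x)\,d\mathbf x$ and $l_{\mathrm{discrete}}(\mathbf e)=-\frac1n\sum_{i=1}^n\log\sum_{j=1}^m(\mathcal N_he_j)(\mathbf x_i)+\int\sum_{j=1}^m e_j(\mathbf x)\,d\mathbf x$. Kullback-Leibler divergence of nonnegative functions: $KL(g_1,g_2)=\int\left[g_1\log\frac{g_1}{g_2}+g_2-g_1\right]$.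 NSMM (nonlinearly smoothed majorization-minimization) steps. Put $w_j(\mathbf x)=(\mathcal N_he_j)(\mathbf x)\big/\sum_{j'=1}^m(\mathcal N_he_{j'})(\mathbf x)$. The continuous one-step update is $$(G(\mathbf e))_j(\mathbf u)=\frac{\prod_{k=1}^r\int g(\mathbf x)w_j(\mathbf x)s_h(u_k,x_k)\,d\mathbf x}{\left[\int g(\mathbf x)w_j(\mathbf x)\,d\mathbf x\right]^{r-1}},$$ and the discrete one-step update is $$(G_{\mathrm{discrete}}(\mathbf e))_j(\mathbf u)=\frac{\prod_{k=1}^r\sum_{i=1}^n\frac1nw_j(\mathbf x_i)s_h(u_k,x_{ik})}{\left(\sum_{i=1}^n\frac1nw_j(\mathbf x_i)\right)^{r-1}},\qquad 1\le j\le m.$$ *)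

(* Defs.v *)
From HB Require Import structures.
From mathcomp Require Import all_boot all_order all_algebra.
From mathcomp Require Import all_classical all_reals all_analysis.
Set Implicit Arguments.
Unset Strict Implicit.
Unset Printing Implicit Defensive.
Import Order.TTheory GRing.Theory Num.Theory.
Import numFieldNormedType.Exports.
Local Open Scope classical_set_scope.
Local Open Scope ring_scope.

(* [R^r] is [r.-tuple R], which has a product sigma-algebra in the library but
   no product measure: Lebesgue measure on [R^r] is built by pushing
   [lebesgue_measure \x lebesgue_tuple R n] forward along [tcons]. *)

Notation Rtuple R r := (r.-tuple (measurableTypeR R)).

Section cons_measure.
Local Open Scope ereal_scope.
Context (R : realType) (n : nat).
Variable mu : {sigma_finite_measure set (Rtuple R n) -> \bar R}.

Definition tcons (p : measurableTypeR R * Rtuple R n) : Rtuple R n.+1 :=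
  [tuple of p.1 :: p.2].

Lemma measurable_tcons : measurable_fun setT tcons.
Proof. exact: (measurable_cons measurable_fst measurable_snd). Qed.

Definition cons_measure : set (Rtuple R n.+1) -> \bar R :=
  pushforward (@lebesgue_measure R \x mu) tcons.


Let cons_measure0 : cons_measure set0 = 0.
Proof. by rewrite /cons_measure /pushforward preimage_set0 measure0. Qed.

Let cons_measure_ge0 A : 0 <= cons_measure A.
Proof. by apply: (measure_ge0 (@lebesgue_measure R \x mu)%E). Qed.

Let cons_measure_sigma_additive : semi_sigma_additive cons_measure.
Proof.
move=> F mF tF mUF; rewrite /cons_measure /pushforward preimage_bigcup.
have m A : measurable A -> measurable (tcons @^-1` A).
  by move=> mA; rewrite -[X in measurable X]setTI; exact: measurable_tcons.
apply: measure_semi_sigma_additive.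
- by move=> k; exact: m.
- apply/trivIsetP => /= i j _ _ ij; rewrite -preimage_setI.
  by move/trivIsetP : tF => /(_ _ _ _ _ ij) ->//; rewrite preimage_set0.
- by rewrite -preimage_bigcup; exact: m.
Qed.

HB.instance Definition _ := isMeasure.Build _ _ _ cons_measure
  cons_measure0 cons_measure_ge0 cons_measure_sigma_additive.

Let cons_measure_sigma_finite : sigma_finite setT cons_measure.
Proof.
have /sigma_finiteP[F [TF ndF Foo]] := sigma_finiteT (@lebesgue_measure R).
have /sigma_finiteP[G [TG ndG Goo]] := sigma_finiteT mu.
pose uncons (t : Rtuple R n.+1) : measurableTypeR R * Rtuple R n :=
  (thead t, [tuple of behead t]).
have unconsK p : uncons (tcons p) = p.
  by case: p => x t; rewrite /uncons /tcons theadE; congr pair; exact: val_inj.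
have muncons : measurable_fun setT uncons.
  by apply/measurable_fun_pairP; split;
    [exact: (@measurable_tnth _ _ _ ord0)|exact: measurable_behead].
exists (fun k => uncons @^-1` (F k `*` G k)).
  apply/seteqP; split=> // t _.
  have [i _ Fi] : (\bigcup_i F i) (uncons t).1 by rewrite -TF.
  have [j _ Gj] : (\bigcup_i G i) (uncons t).2 by rewrite -TG.
  exists (maxn i j) => //; split.
    by move: Fi; exact/subsetPset/ndF/leq_maxl.
  by move: Gj; exact/subsetPset/ndG/leq_maxr.
move=> k; have [mF Fkoo] := Foo k; have [mG Gkoo] := Goo k; split.
  by rewrite -[X in measurable X]setTI; apply: muncons => //; exact: measurableX.
rewrite /cons_measure /pushforward -comp_preimage.
rewrite (_ : uncons \o tcons = id); last exact/funext.
by rewrite preimage_id product_measure1E// lte_mul_pinfty// ge0_fin_numE.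
Qed.

HB.instance Definition _ := Measure_isSigmaFinite.Build _ _ _ cons_measure
  cons_measure_sigma_finite.

End cons_measure.

Fixpoint lebesgue_tuple (R : realType) (n : nat) :
    {sigma_finite_measure set (Rtuple R n) -> \bar R} :=
  if n is k.+1 then cons_measure (lebesgue_tuple R k)
  else dirac ([tuple] : Rtuple R 0).

Lemma lebesgue_tuple_box (R : realType) n (A : 'I_n -> set (measurableTypeR R)) :
  (forall i, measurable (A i)) ->
  lebesgue_tuple R n [set x | forall i, A i (tnth x i)] =
  (\prod_(i < n) lebesgue_measure (A i))%E.
Proof.
elim: n A => [A _|n IH A mA].
  rewrite big_ord0 /= diracE mem_set//.
  by case.
rewrite big_ord_recl /= /cons_measure /pushforward.
rewrite -(IH (fun i => A (lift ord0 i)))// -product_measure1E//; last first.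
  rewrite (_ : mkset _ = \bigcap_(i in [set: 'I_n]) (@tnth _ _ ^~ i) @^-1` A (lift ord0 i)).
    apply: fin_bigcap_measurable => // i _.
    by rewrite -[X in measurable X]setTI; exact: measurable_tnth.
  by apply/seteqP; split => [x xA i _|x xA i]; [exact: xA|exact: xA].
congr (_ _); apply/seteqP; split => -[x t] /= H.
  split=> [|i]; first exact: (H ord0).
  by have := H (lift ord0 i); rewrite /tcons tnthS.
move=> i; have [j ->|->] := unliftP ord0 i; first by rewrite /tcons tnthS; exact: H.2.
exact: H.1.
Qed.

Section nsmm.
Context (R : realType) (r : nat).
Local Notation point := (Rtuple R r).
Local Notation mu := (lebesgue_tuple R r).
Implicit Types (a b : R) (s : R -> R -> R) (f g : point -> R).

Definition Omega a b : set point := [set x | forall k, tnth x k \in `[a, b]].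

(* Tuples carry no topology in the library; supports and interiors are taken
   in ['rV[R]_r]. *)
Definition row_of (x : point) : 'rV[R]_r := \row_k tnth x k.

Definition tsupport f : set 'rV[R]_r := closure (row_of @` [set x | f x != 0]).

Definition is_density g : Prop :=
  [/\ measurable_fun setT g, (forall x, 0 <= g x) &
      (\int[mu]_x (g x)%:E = 1)%E].

Definition target_density a b g : Prop :=
  is_density g /\ tsupport g `<=` (row_of @` Omega a b)°.

Record smoothing_kernel a b s (M1 M2 B : R) : Prop := SmoothingKernel {
  kernel_L1 : (@lebesgue_measure R \x @lebesgue_measure R)%E.-integrable setT
    (fun p => (s p.1 p.2)%:E);
  kernel_ge0 : forall v z, 0 <= s v z;
  kernel_support : forall v z, s v z != 0 -> v \in `[a, b] /\ z \in `[a, b];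
  kernel_int_r : forall v, v \in `[a, b] ->
    (\int[lebesgue_measure]_u (s v u)%:E = 1)%E;
  kernel_int_l : forall z, z \in `[a, b] ->
    (\int[lebesgue_measure]_u (s u z)%:E = 1)%E;
  kernel_M1_gt0 : 0 < M1;
  kernel_M2_gt0 : 0 < M2;
  kernel_bounds : forall v z, v \in `[a, b] -> z \in `[a, b] ->
    M1 <= s v z <= M2;
  kernel_d1 : forall p : R * R, p.1 \in `]a, b[ -> p.2 \in `]a, b[ ->
    [/\ derivable (s ^~ p.2) p.1 1,
        {for p, continuous (fun q : R * R => derive1 (s ^~ q.2) q.1)} &
        `|derive1 (s ^~ p.2) p.1| <= B];
  kernel_d2 : forall p : R * R, p.1 \in `]a, b[ -> p.2 \in `]a, b[ ->
    [/\ derivable (s p.1) p.2 1,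
        {for p, continuous (fun q : R * R => derive1 (s q.1) q.2)} &
        `|derive1 (s p.1) p.2| <= B]
}.

Definition stilde s (x u : point) : R := \prod_(k < r) s (tnth x k) (tnth u k).

Definition Sstar s f (x : point) : R := \int[mu]_u (stilde s u x * f u).

(* [ln] is 0 on nonpositive reals; this is only reached outside [Omega], where
   [stilde] vanishes, as the functions smoothed below are positive on [Omega]. *)
Definition Nsm a b s f (x : point) : R :=
  if x \in Omega a b then expR (Sstar s (fun u => ln (f u)) x) else 0.

(* [x * log (x / y)], with [0 * log (0 / y) = 0], and [+oo] if [x != 0 = y]. *)
Definition xlog (x y : R) : \bar R :=
  if x == 0 then 0%E else if y == 0 then +oo%E else (x * ln (x / y))%:E.

Definition KL (g1 g2 : point -> R) : \bar R :=
  (\int[mu]_x (xlog (g1 x) (g2 x) + (g2 x - g1 x)%:E))%E.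

Section components.
Context (m : nat).
Implicit Type e : 'I_m -> point -> R.

(* The components of the target are only asked to be nonnegative: a sum of
   products positive on [Omega] could not be supported in its interior.
   Positivity, product form and lower bound are asked of candidates. *)
Definition sum_of_nonneg g : Prop :=
  exists e, (forall j x, 0 <= e j x) /\ forall x, g x = \sum_(j < m) e j x.

Definition product_components a b e : Prop :=
  forall j, exists (theta : R) (ek : 'I_r -> R -> R),
    [/\ 0 < theta,
        (forall k, (@lebesgue_measure R).-integrable setT
                     (fun t => (ek k t)%:E)),
        (forall k t, t \in `[a, b] -> 0 < ek k t),
        (forall k t, t \notin `[a, b] -> ek k t = 0) &
        forall x, e j x = theta * \prod_(k < r) ek k (tnth x k)].

Definition bounded_below a b (M1 : R) e : Prop :=
  forall j x, Omega a b x -> M1 ^+ r <= e j x / \int[mu]_z e j z.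

Definition candidate a b M1 e : Prop :=
  product_components a b e /\ bounded_below a b M1 e.

Definition Nsum a b s e (x : point) : R := \sum_(j < m) Nsm a b s (e j) x.

Definition weight a b s e j (x : point) : R :=
  Nsm a b s (e j) x / Nsum a b s e x.

Definition G a b s g e : 'I_m -> point -> R := fun j u =>
  (\prod_(k < r)
     \int[mu]_x (g x * weight a b s e j x * s (tnth u k) (tnth x k)))
  / (\int[mu]_x (g x * weight a b s e j x)) ^+ r.-1.

(* Extended-valued: on candidates it is [+oo] exactly when [g * log g] has
   infinite integral. *)
Definition objective a b s g e : \bar R :=
  (\int[mu]_x xlog (g x) (Nsum a b s e x)
   + \int[mu]_x (\sum_(j < m) e j x)%R%:E)%E.

Section discrete.
Context (n : nat).
Implicit Type X : 'I_n -> point.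

Definition G_discrete a b s X e : 'I_m -> point -> R := fun j u =>
  (\prod_(k < r) \sum_(i < n)
     n%:R^-1 * weight a b s e j (X i) * s (tnth u k) (tnth (X i) k))
  / (\sum_(i < n) n%:R^-1 * weight a b s e j (X i)) ^+ r.-1.

Definition objective_discrete a b s X e : \bar R :=
  ((- (n%:R^-1 * \sum_(i < n) ln (Nsum a b s e (X i))))%R%:E
   + \int[mu]_x (\sum_(j < m) e j x)%R%:E)%E.

End discrete.
End components.
End nsmm.

(* Main.v *)
(* Write N_j for [Nsm (e j)], w_j for the weights and I for the average over the
   target (or over the sample).  By concavity of the logarithm, the decrease of
   the likelihood part is at least the sum over j of
   I (w_j (log N'_j - log N_j)), which by Fubini is the integral of
   A_j log (e'_j / e_j) with A_j u = I (w_j stilde u).  On [Omega],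
   log (e'_j / e_j) is a sum of functions of one coordinate, and e'_j is the
   normalized product of the one-dimensional marginals of A_j, so A_j may be
   replaced by e'_j; this leaves the divergence of e'_j from e_j up to the
   difference of the total masses, which the penalty term supplies. *)
Require Import Defs.
From HB Require Import structures.
From mathcomp Require Import all_boot all_order all_algebra.
From mathcomp Require Import all_classical all_reals all_analysis.
From mathcomp Require Import measurable_realfun lra ring.
Set Implicit Arguments.
Unset Strict Implicit.
Unset Printing Implicit Defensive.
Import Order.TTheory GRing.Theory Num.Theory.
Import numFieldNormedType.Exports.
Local Open Scope classical_set_scope.
Local Open Scope ring_scope.

(** The obstacle is integrability of logarithms: splitting the logarithm of a product under an
    integral and exchanging integrals requires each [ln (q k)] to be integrable on the line. For a
    candidate this is extracted from the lower bound (vi); for an update it follows from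
    [M1 <= s <= M2], which squeezes the factors between positive constants on [[a, b]]. The
    invariant of the iteration is therefore [separable] rather than [candidate]. Since the kernel is
    bounded by [M2], smoothing turns an integrable logarithm into a bounded one; hence every
    [ln N_j] is bounded on [Omega], the weights are bounded away from 0 there, and all averages in
    the argument are finite. The only quantity that may be infinite is the integral of [g * ln g],
    which does not depend on [e]; it is the source of the twofold conclusion in the continuous case.
    Both versions of the algorithm share one proof, written for an abstract average [I]. *)

Section real_integrable.
Context d (T : measurableType d) (R : realType).
Variable mu : {measure set T -> \bar R}.
Implicit Types f g h : T -> R.

Definition summable_fun f := mu.-integrable setT (fun x => (f x)%:E).

Lemma summable_fun_measurable f : summable_fun f -> measurable_fun setT f.
Proof. by move=> /(measurable_int mu)/measurable_EFinP. Qed.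

Lemma eq_summable_fun f g : f =1 g -> summable_fun f -> summable_fun g.
Proof. by move=> /funext ->. Qed.

Lemma summable_fun0 : summable_fun (fun=> 0).
Proof. exact: integrable0. Qed.

Lemma summable_funD f g :
  summable_fun f -> summable_fun g -> summable_fun (fun x => f x + g x).
Proof. by move=> fi gi; have := integrableD measurableT fi gi. Qed.

Lemma summable_funB f g :
  summable_fun f -> summable_fun g -> summable_fun (fun x => f x - g x).
Proof. by move=> fi gi; have := integrableB measurableT fi gi. Qed.

Lemma summable_funZl c f : summable_fun f -> summable_fun (fun x => c * f x).
Proof. by move=> fi; have := integrableZl measurableT c fi. Qed.

Lemma summable_fun_norm f : summable_fun f -> summable_fun (fun x => `|f x|).
Proof. exact: integrable_norm. Qed.

Lemma le_summable_fun f g : measurable_fun setT f ->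
  (forall x, `|f x| <= g x) -> summable_fun g -> summable_fun f.
Proof.
move=> mf fg ig; apply: le_integrable ig => //; first exact/measurable_EFinP.
by move=> x _; rewrite /= lee_fin (le_trans (fg x))// ler_norm.
Qed.

Lemma summable_fun_sum (J : Type) (l : seq J) (F : J -> T -> R) :
  (forall j, summable_fun (F j)) -> summable_fun (fun x => \sum_(j <- l) F j x).
Proof.
move=> Fi; elim: l => [|j l IH].
  by apply: (eq_summable_fun _ summable_fun0) => x; rewrite big_nil.
by apply: (eq_summable_fun _ (summable_funD (Fi j) IH)) => x; rewrite big_cons.
Qed.

Lemma Rintegral_sum (J : Type) (l : seq J) (F : J -> T -> R) :
  (forall j, summable_fun (F j)) ->
  \int[mu]_x \sum_(j <- l) F j x = \sum_(j <- l) \int[mu]_x F j x.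
Proof.
move=> Fi; elim: l => [|j l IH].
  rewrite big_nil; under eq_Rintegral do rewrite big_nil.
  by rewrite /Rintegral integral0.
rewrite big_cons -IH -RintegralD//; [|exact: Fi|exact: summable_fun_sum].
by apply: eq_Rintegral => x _; rewrite big_cons.
Qed.

Lemma summable_fun_fineK f : summable_fun f ->
  (\int[mu]_x f x)%:E = (\int[mu]_x (f x)%:E)%E.
Proof. by move=> fi; rewrite fineK//; exact: integrable_fin_num. Qed.

(** The negative part of [f] is dominated by the positive part of [h], so its integral is finite and
    the positive part alone decides. *)
Lemma summable_fun_or_pinfty f h : measurable_fun setT f -> summable_fun h ->
  (forall x, - h x <= f x) ->
  summable_fun f \/ (\int[mu]_x (f x)%:E = +oo)%E.
Proof.
move=> mf hi hf.
have mF : measurable_fun setT (EFin \o f) by exact/measurable_EFinP.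
have fn : (\int[mu]_x ((fun x => (f x)%:E)^\- x) < +oo)%E.
  apply: le_lt_trans (integral_funepos_lt_pinfty measurableT hi).
  apply: ge0_le_integral => //.
  - exact: measurable_funeneg.
  - by move/(measurable_int mu) : hi => ?; exact: measurable_funepos.
  - move=> x _; rewrite funenegE funeposE /=.
    rewrite -!EFin_max lee_fin ge_max !le_max lerNl hf/=.
    by rewrite lexx orbT.
have fn' : (\int[mu]_x ((fun x => (f x)%:E)^\- x) \is a fin_num)%E.
  by rewrite ge0_fin_numE// integral_ge0.
have [fp|fp] := ltP (\int[mu]_x ((fun x => (f x)%:E)^\+ x))%E +oo%E;
  [left|right].
  apply/integrableP; split => //.
  rewrite -[fun x => _]/(abse \o (fun x => (f x)%:E)) fune_abse.
  rewrite ge0_integralD//; first exact: lte_add_pinfty.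
  - exact: measurable_funepos.
  - exact: measurable_funeneg.
rewrite integralE; move: fp; rewrite leye_eq => /eqP ->.
by rewrite addye// eqe_oppLR/= ; move: fn'; rewrite fin_numE => /andP[].
Qed.

End real_integrable.
Arguments summable_fun {d T R} mu f.

(** * Fubini for real-valued integrals, and products of one-variable functions on R^r *)

Section product_integrals.
Context d1 d2 (T1 : measurableType d1) (T2 : measurableType d2) (R : realType).
Variable m1 : {sigma_finite_measure set T1 -> \bar R}.
Variable m2 : {sigma_finite_measure set T2 -> \bar R}.

Lemma summable_fun_prod (f : T1 -> R) (g : T2 -> R) :
  summable_fun m1 f -> summable_fun m2 g ->
  summable_fun (m1 \x m2)%E (fun p => f p.1 * g p.2).
Proof.
move=> fi gi.
have mfg : measurable_fun setT (fun p : T1 * T2 => f p.1 * g p.2).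
  apply: measurable_funM.
    exact: measurableT_comp (summable_fun_measurable fi) measurable_fst.
  exact: measurableT_comp (summable_fun_measurable gi) measurable_snd.
apply/integrable12ltyP; first exact/measurable_EFinP.
under eq_integral => x _.
  under eq_integral => y _ do rewrite /= normrM EFinM.
  rewrite integralZl//; last exact: summable_fun_norm.
  rewrite -summable_fun_fineK; last exact: summable_fun_norm.
  over.
rewrite integralZr//; last exact: summable_fun_norm.
rewrite -summable_fun_fineK; last exact: summable_fun_norm.
by rewrite -EFinM ltry.
Qed.

(** Summability is asked of every section, not almost every one, so that each inner extended
    integral is the embedding of a real one. *)
Lemma Rintegral_Fubini (f : T1 -> T2 -> R) :
  summable_fun (m1 \x m2)%E (fun p => f p.1 p.2) ->
  (forall x, summable_fun m2 (f x)) -> (forall y, summable_fun m1 (f ^~ y)) ->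
  \int[m1]_x \int[m2]_y f x y = \int[m2]_y \int[m1]_x f x y.
Proof.
move=> fi f1 f2; rewrite /Rintegral.
have := Fubini fi; rewrite /=.
under [LHS]eq_integral => x _ do rewrite -(summable_fun_fineK (f1 x)).
under [RHS]eq_integral => y _ do rewrite -(summable_fun_fineK (f2 y)).
by move=> ->.
Qed.

Lemma Rintegral_prod (f : T1 -> R) (g : T2 -> R) :
  summable_fun m1 f -> summable_fun m2 g ->
  (\int[m1 \x m2]_p (f p.1 * g p.2)%:E = (\int[m1]_x f x * \int[m2]_y g
    y)%:E)%E.
Proof.
move=> fi gi; rewrite -(integral12_prod_meas1 (summable_fun_prod fi gi))
  /fubini_F /=.
under eq_integral => x _.
  under eq_integral => y _ do rewrite EFinM.
  rewrite integralZl// -summable_fun_fineK//.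
  over.
by rewrite integralZr// -summable_fun_fineK.
Qed.

Lemma measurable_Rintegral1 (f : T1 -> T2 -> R) :
  summable_fun (m1 \x m2)%E (fun p => f p.1 p.2) ->
  measurable_fun setT (fun y => \int[m1]_x f x y).
Proof.
move=> fi; apply: (@measurableT_comp _ _ _ _ _ _ fine) => //.
exact: (measurable_fubini_G fi).
Qed.

End product_integrals.

Section tuple_integrals.
Context (R : realType).
Local Notation leb := (@lebesgue_measure R).

(** The measure is a pushforward along [tcons], so a change of variables splits off the first
    coordinate. The induction starts from a Dirac mass, against which the empty product integrates
    to 1. *)
Lemma lebesgue_tuple_prod n (f : 'I_n -> R -> R) :
  (forall k, summable_fun leb (f k)) ->
  summable_fun (lebesgue_tuple R n) (fun x => \prod_(k < n) f k (tnth x k)) /\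
  \int[lebesgue_tuple R n]_x \prod_(k < n) f k (tnth x k) =
  \prod_(k < n) \int[leb]_t f k t.
Proof.
elim: n f => [|n IH] f fi.
  split.
    apply: (@eq_summable_fun _ _ _ _ (fun=> 1)) => [x|];
      first by rewrite big_ord0.
    exact: finite_measure_integrable_cst.
  rewrite big_ord0; under eq_Rintegral do rewrite big_ord0.
  by rewrite Rintegral_cst//= indicT mul1r.
have [IH1 IH2] := IH (fun k => f (lift ord0 k)) (fun k => fi _).
pose F (x : Rtuple R n.+1) := (\prod_(k < n.+1) f k (tnth x k)).
have mF : measurable_fun setT F.
  apply: measurable_prod => k _; apply: measurableT_comp.
    exact: summable_fun_measurable (fi k).
  exact: measurable_tnth.
have Fc (p : measurableTypeR R * Rtuple R n) :
    F (tcons p) = f ord0 p.1 * \prod_(k < n) f (lift ord0 k) (tnth p.2 k).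
  rewrite /F big_ord_recl; congr (f _ _ * _).
  by apply: eq_bigr => k _; rewrite /tcons tnthS.
have Fi : summable_fun (leb \x lebesgue_tuple R n)%E (F \o @tcons R n).
  by apply: (eq_summable_fun _ (summable_fun_prod (fi ord0) IH1)) => p;
    rewrite /= Fc.
have mE : measurable_fun setT (EFin \o F) by exact/measurable_EFinP.
have tT : @tcons R n @^-1` setT = setT by rewrite preimage_setT.
pose lebx : {measure set _ -> \bar R} := (leb \x lebesgue_tuple R n)%E.
have Fi' : lebx.-integrable (@tcons R n @^-1` setT) ((EFin \o F) \o @tcons R n).
  by rewrite tT.
split.
  exact: (integrable_pushforward (@measurable_tcons R n) mE Fi' measurableT).
rewrite big_ord_recl -IH2 /Rintegral -[RHS]/(fine _%:E) -Rintegral_prod//.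
congr fine.
rewrite [LHS](integral_pushforward (@measurable_tcons R n) mE Fi' measurableT)
  tT.
by apply: eq_integral => p _; rewrite /= Fc.
Qed.

End tuple_integrals.

Lemma ln_prod (R : realType) (J : Type) (l : seq J) (F : J -> R) :
  (forall j, 0 < F j) -> ln (\prod_(j <- l) F j) = \sum_(j <- l) ln (F j).
Proof.
move=> F0; elim: l => [|j l IH]; first by rewrite !big_nil ln1.
by rewrite !big_cons lnM ?posrE ?IH// prodr_gt0.
Qed.

(** The tangent at 1 is the only form in which concavity is used: for the Jensen step and for the
    lower bound on the loss. *)
Lemma ln_le_subr1 (R : realType) (x : R) : 0 < x -> ln x <= x - 1.
Proof.
by move=> x0; have := @le_ln1Dx R (x - 1); rewrite subrKC; apply; lra.
Qed.

Section separable_weights.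
Context (R : realType) (r : nat).
Local Notation leb := (@lebesgue_measure R).
Local Notation mu := (lebesgue_tuple R r).

(** Absorbing [phi] into the [k]-th factor leaves a pure product. *)
Lemma lebesgue_tuple_prodM (q : 'I_r -> R -> R) (phi : R -> R) (k : 'I_r) :
  (forall l, summable_fun leb (q l)) ->
  summable_fun leb (fun t => q k t * phi t) ->
  summable_fun mu (fun u => (\prod_(l < r) q l (tnth u l)) * phi (tnth u k)) /\
  \int[mu]_u ((\prod_(l < r) q l (tnth u l)) * phi (tnth u k)) =
  (\int[leb]_t (q k t * phi t)) * \prod_(l < r | l != k) \int[leb]_t q l t.
Proof.
move=> qi qphi.
pose q' l t := if l == k then q k t * phi t else q l t.
have q'i l : summable_fun leb (q' l).
  by rewrite /q'; case: eqVneq => _; [exact: qphi|exact: qi].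
have q'E (u : Rtuple R r) :
    \prod_(l < r) q' l (tnth u l) =
    (\prod_(l < r) q l (tnth u l)) * phi (tnth u k).
  rewrite (bigD1 k)//= [in RHS](bigD1 k)//= /q' eqxx mulrAC; congr (_ * _ * _).
  by apply: eq_bigr => l /negPf ->.
have [q'1 q'2] := lebesgue_tuple_prod q'i; split.
  exact: eq_summable_fun q'1.
under eq_Rintegral do rewrite -q'E.
rewrite q'2 (bigD1 k)//=; congr (_ * _).
  by apply: eq_Rintegral => t _; rewrite /q' eqxx.
by apply: eq_bigr => l /negPf lk; apply: eq_Rintegral => t _; rewrite /q' lk.
Qed.

(** Used with two families [q]: kernel slices, when smoothing the logarithm of a product, and
    marginals of the update, when computing the divergence. *)
Lemma lebesgue_tuple_prod_sum (q phi : 'I_r -> R -> R) (c : R) :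
  (forall l, summable_fun leb (q l)) ->
  (forall k, summable_fun leb (fun t => q k t * phi k t)) ->
  let f u := (\prod_(l < r) q l (tnth u l)) * (c + \sum_(k < r) phi k (tnth u
    k)) in
  summable_fun mu f /\
  \int[mu]_u f u = c * (\prod_(l < r) \int[leb]_t q l t) +
   \sum_(k < r) (\int[leb]_t (q k t * phi k t))
                * \prod_(l < r | l != k) \int[leb]_t q l t.
Proof.
move=> qi qphi f.
have [p1 p2] := lebesgue_tuple_prod qi.
have pk k := lebesgue_tuple_prodM qi (qphi k).
pose h k (u : Rtuple R r) := (\prod_(l < r) q l (tnth u l)) * phi k (tnth u k).
have fE u : c * (\prod_(l < r) q l (tnth u l)) + \sum_(k < r) h k u = f u.
  by rewrite /f mulrDr mulr_sumr [_ * c]mulrC.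
have hi : summable_fun mu (fun u => \sum_(k < r) h k u).
  by apply: summable_fun_sum => k; exact: (pk k).1.
split; first by apply: (eq_summable_fun _ (summable_funD (summable_funZl c p1)
  hi)) => u; exact: fE.
under eq_Rintegral do rewrite -fE.
rewrite RintegralD//; last exact: summable_funZl.
rewrite RintegralZl// p2 Rintegral_sum; last by move=> k; exact: (pk k).1.
by congr (_ + _); apply: eq_bigr => k _; exact: (pk k).2.
Qed.

End separable_weights.

(** * Smoothing of separable functions, and functions bounded on the cube *)

Section kernel.
Context (R : realType) (r : nat) (a b : R) (s : R -> R -> R) (M1 M2 B : R).
Hypothesis kern : smoothing_kernel a b s M1 M2 B.
Local Notation leb := (@lebesgue_measure R).
Local Notation mu := (lebesgue_tuple R r).
Local Notation Om := (@Omega R r a b).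

(** Scaled by a constant, it is the integrable majorant of bounded functions supported in [[a, b]];
    it also stands in for the constant 1, which is not integrable on the line. *)
Definition ind_ab : R -> R := \1_(`[a, b]%classic).

Lemma ind_ab_in t : t \in `[a, b] -> ind_ab t = 1.
Proof. by move=> tab; rewrite /ind_ab indicE mem_set. Qed.

Lemma ind_ab_notin t : t \notin `[a, b] -> ind_ab t = 0.
Proof. by move=> tab; rewrite /ind_ab indicE memNset//; exact/negP. Qed.

Lemma summable_ind_ab : summable_fun leb ind_ab.
Proof. exact: integrable_indic_itv. Qed.

Lemma kernel_out1 t z : t \notin `[a, b] -> s t z = 0.
Proof. by move=> tab; apply/eqP; apply: contraNT tab =>
  /(kernel_support kern)[]. Qed.

Lemma kernel_out2 t z : z \notin `[a, b] -> s t z = 0.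
Proof. by move=> tab; apply/eqP; apply: contraNT tab =>
  /(kernel_support kern)[]. Qed.

Lemma measurable_kernel : measurable_fun setT
  (fun p : measurableTypeR R * measurableTypeR R => s p.1 p.2).
Proof. by have /(measurable_int _)/measurable_EFinP := kernel_L1 kern. Qed.

Lemma measurable_kernel1 z : measurable_fun setT (s ^~ z : measurableTypeR R ->
  R).
Proof. exact: (measurable_fun_pair1 z measurable_kernel). Qed.

Lemma measurable_kernel2 t : measurable_fun setT (s t : measurableTypeR R -> R).
Proof. exact: (measurable_fun_pair2 t measurable_kernel). Qed.

Lemma kernel_le_ind1 t z : s t z <= M2 * ind_ab t.
Proof.
have [tab|tab] := boolP (t \in `[a, b]); last by rewrite kernel_out1//
  ind_ab_notin ?mulr0.
rewrite ind_ab_in// mulr1.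
have [zab|zab] := boolP (z \in `[a, b]).
  by have /andP[] := kernel_bounds kern tab zab.
by rewrite kernel_out2// ltW// (kernel_M2_gt0 kern).
Qed.

Lemma kernel_le_ind2 t z : s t z <= M2 * ind_ab z.
Proof.
have [zab|zab] := boolP (z \in `[a, b]); last by rewrite kernel_out2//
  ind_ab_notin ?mulr0.
rewrite ind_ab_in// (le_trans (kernel_le_ind1 _ _))//
  ler_pM2l ?(kernel_M2_gt0 kern)//.
by rewrite /ind_ab indicE; case: (_ \in _).
Qed.

Lemma kernel_leM2 t z : s t z <= M2.
Proof.
rewrite (le_trans (kernel_le_ind1 t z))// ger_pMr ?(kernel_M2_gt0 kern)//.
by rewrite /ind_ab indicE; case: (_ \in _).
Qed.

Lemma kernel_norm t z : `|s t z| = s t z.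
Proof. by rewrite ger0_norm// (kernel_ge0 kern). Qed.

Lemma summable_kernel z : summable_fun leb (s ^~ z).
Proof.
apply: le_summable_fun (summable_funZl M2 summable_ind_ab).
  exact: measurable_kernel1.
by move=> t; rewrite kernel_norm kernel_le_ind1.
Qed.

Lemma Rintegral_kernel z : z \in `[a, b] -> \int[leb]_t s t z = 1.
Proof. by move=> zab; rewrite /Rintegral (kernel_int_l kern). Qed.

Definition smooth1 (phi : R -> R) (z : R) : R := \int[leb]_t (s t z * phi t).

Section smooth1.
Variable phi : R -> R.
Hypothesis phii : summable_fun leb phi.

Lemma summable_smooth1 z : summable_fun leb (fun t => s t z * phi t).
Proof.
apply: le_summable_fun (summable_funZl M2 (summable_fun_norm phii)).
  apply: measurable_funM; first exact: measurable_kernel1.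
  exact: (summable_fun_measurable phii).
by move=> t; rewrite normrM kernel_norm ler_wpM2r// kernel_leM2.
Qed.

(** The support of the kernel in its second variable supplies the decay in [z]; this joint
    integrability makes [smooth1] measurable. *)
Lemma summable_smooth1_prod : summable_fun (leb \x leb)%E
  (fun p => s p.1 p.2 * phi p.1).
Proof.
apply: le_summable_fun (summable_fun_prod (summable_fun_norm phii)
  (summable_funZl M2 summable_ind_ab)).
  apply: measurable_funM; first exact: measurable_kernel.
  exact: measurableT_comp (summable_fun_measurable phii) measurable_fst.
move=> p; rewrite normrM kernel_norm mulrC ler_wpM2l//; exact: kernel_le_ind2.
Qed.

Lemma measurable_smooth1 : measurable_fun setT (smooth1 phi : measurableTypeR R
  -> R).
Proof.
exact: (measurable_Rintegral1 (f := fun t z : measurableTypeR R =>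
  s t z * phi t) summable_smooth1_prod).
Qed.

(** Uniform in [z] although [phi] is merely integrable: an unbounded [ln (q k)] becomes bounded
    after smoothing. *)
Lemma smooth1_bounded z : `|smooth1 phi z| <= M2 * \int[leb]_t `|phi t|.
Proof.
apply: (le_trans (le_normr_Rintegral measurableT (summable_smooth1 z))).
rewrite -RintegralZl//; last exact: summable_fun_norm.
apply: le_Rintegral => //.
- exact: summable_fun_norm (summable_smooth1 z).
- exact/summable_funZl/summable_fun_norm.
- by move=> t _; rewrite normrM kernel_norm ler_wpM2r// kernel_leM2.
Qed.

End smooth1.

(** The invariant of the iteration. In place of the lower bound asked of a candidate it records
    integrability of the logarithms of the factors, a property that passes to updates. Outside
    [[a, b]] these logarithms are [ln 0 = 0]. *)
Record separable (theta : R) (q : 'I_r -> R -> R) (f : Rtuple R r -> R) : Prop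
  :=
  Separable {
    sep_theta : 0 < theta;
    sep_summable : forall k, summable_fun leb (q k);
    sep_gt0 : forall k t, t \in `[a, b] -> 0 < q k t;
    sep_out : forall k t, t \notin `[a, b] -> q k t = 0;
    sep_summable_ln : forall k, summable_fun leb (fun t => ln (q k t));
    sepE : forall x, f x = theta * \prod_(k < r) q k (tnth x k)
  }.

Section separable.
Variables (theta : R) (q : 'I_r -> R -> R) (f : Rtuple R r -> R).
Hypothesis sf : separable theta q f.

Lemma separable_gt0 x : Om x -> 0 < f x.
Proof.
move=> Ox; rewrite (sepE sf) mulr_gt0 ?(sep_theta sf)// prodr_gt0// => k _.
exact/(sep_gt0 sf)/Ox.
Qed.

Lemma separable_out x : ~ Om x -> f x = 0.
Proof.
move=> /existsNP[k /negP xk]; rewrite (sepE sf) (bigD1 k)//= (sep_out sf)//.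
by rewrite mul0r mulr0.
Qed.

Lemma separable_summable : summable_fun mu f.
Proof.
have [fi _] := lebesgue_tuple_prod (sep_summable sf).
by apply: (eq_summable_fun _ (summable_funZl theta fi)) => x; rewrite (sepE sf).
Qed.

Lemma separable_ln x : Om x ->
  ln (f x) = ln theta + \sum_(k < r) ln (q k (tnth x k)).
Proof.
move=> Ox; have qx k : 0 < q k (tnth x k) by exact/(sep_gt0 sf)/Ox.
rewrite (sepE sf) lnM ?posrE ?(sep_theta sf)// ?ln_prod//.
by rewrite prodr_gt0.
Qed.

Lemma stilde_out x u : ~ Om u -> stilde s u x = 0.
Proof.
by move=> /existsNP[k /negP xk]; rewrite /stilde (bigD1 k)//= kernel_out1
  ?mul0r.
Qed.

Lemma Sstar_ln x : Om x -> Sstar s (fun u => ln (f u)) x =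
  ln theta + \sum_(k < r) smooth1 (fun t => ln (q k t)) (tnth x k).
Proof.
move=> Ox.
have kk k : \int[leb]_t s t (tnth x k) = 1 by exact/Rintegral_kernel/Ox.
transitivity (\int[mu]_u ((\prod_(l < r) s (tnth u l) (tnth x l)) *
    (ln theta + \sum_(k < r) ln (q k (tnth u k))))).
  apply: eq_Rintegral => u _; have [Ou|Ou] := pselect (Om u).
    by rewrite separable_ln.
  by rewrite -/(stilde s u x) stilde_out// !mul0r.
have [_ ->] := lebesgue_tuple_prod_sum (ln theta)
  (fun l => summable_kernel (tnth x l))
  (fun k => summable_smooth1 (sep_summable_ln sf k) (tnth x k)).
(* Each kernel slice at a coordinate of [x] has mass 1, so all the remaining products of masses
   disappear. *)
rewrite big1 ?mulr1//; congr (_ + _); apply: eq_bigr => k _.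
by rewrite big1 ?mulr1.
Qed.

Lemma Nsm_in x : Om x ->
  Nsm a b s f x =
  expR (ln theta + \sum_(k < r) smooth1 (fun t => ln (q k t)) (tnth x k)).
Proof. by move=> Ox; rewrite /Nsm mem_set// Sstar_ln. Qed.

Lemma Nsm_gt0 x : Om x -> 0 < Nsm a b s f x.
Proof. by move=> Ox; rewrite Nsm_in// expR_gt0. Qed.

Lemma ln_Nsm x : Om x -> ln (Nsm a b s f x) =
  ln theta + \sum_(k < r) smooth1 (fun t => ln (q k t)) (tnth x k).
Proof. by move=> Ox; rewrite Nsm_in// expRK. Qed.

End separable.

Lemma Nsm_out f x : ~ Om x -> Nsm a b s f x = 0.
Proof. by move=> Ox; rewrite /Nsm memNset. Qed.

Lemma measurable_Omega : measurable Om.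
Proof.
have mab : measurable (`[a, b]%classic : set (measurableTypeR R)).
  exact: measurable_itv.
rewrite (_ : Om = \bigcap_(k in [set: 'I_r]) (@tnth _ _ ^~ k) @^-1` `[a, b]).
  apply: fin_bigcap_measurable => // k _.
  by rewrite -[X in measurable X]setTI; exact: measurable_tnth.
by apply/seteqP; split => [x Ox k _|x Ox k]; exact: Ox.
Qed.

(** The integrands to be averaged. No bound is asked outside [Omega], because the target and the
    sample are carried by [Omega]. *)
Definition bounded_Omega (f : Rtuple R r -> R) : Prop :=
  measurable_fun setT f /\ exists K : R, forall x, Om x -> `|f x| <= K.

Lemma bounded_Omega_cst c : bounded_Omega (fun=> c).
Proof. by split; [exact: measurable_cst|exists `|c|]. Qed.

Lemma bounded_OmegaD f g :
  bounded_Omega f -> bounded_Omega g -> bounded_Omega (fun x => f x + g x).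
Proof.
move=> [mf [K fK]] [mg [K' gK']]; split; first exact: measurable_funD.
exists (K + K') => x Ox; rewrite (le_trans (ler_normD _ _))// lerD//;
  [exact: fK|exact: gK'].
Qed.

Lemma bounded_OmegaM f g :
  bounded_Omega f -> bounded_Omega g -> bounded_Omega (fun x => f x * g x).
Proof.
move=> [mf [K fK]] [mg [K' gK']]; split; first exact: measurable_funM.
by exists (K * K') => x Ox; rewrite normrM ler_pM//; [exact: fK|exact: gK'].
Qed.

Lemma bounded_OmegaN f : bounded_Omega f -> bounded_Omega (fun x => - f x).
Proof.
move=> [mf [K fK]]; split; first exact: measurable_funN.
by exists K => x Ox; rewrite normrN; exact: fK.
Qed.

Lemma bounded_OmegaB f g :
  bounded_Omega f -> bounded_Omega g -> bounded_Omega (fun x => f x - g x).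
Proof. by move=> bf bg; exact: bounded_OmegaD bf (bounded_OmegaN bg). Qed.

Lemma bounded_Omega_sum (J : Type) (l : seq J) (F : J -> Rtuple R r -> R) :
  (forall j, bounded_Omega (F j)) -> bounded_Omega (fun x =>
    \sum_(j <- l) F j x).
Proof.
move=> bF; elim: l => [|j l IH].
  rewrite (_ : (fun x => _) = fun=> 0); first exact: bounded_Omega_cst.
  by apply/funext => x; rewrite big_nil.
rewrite (_ : (fun x => _) = fun x => F j x + \sum_(j <- l) F j x).
  exact: bounded_OmegaD.
by apply/funext => x; rewrite big_cons.
Qed.

Lemma bounded_Omega_indic : bounded_Omega \1_Om.
Proof.
split.
  have := @measurable_indic _ (Rtuple R r) R setT Om.
  by apply; exact: measurable_Omega.
by exists 1 => x _; rewrite indicE; case: (_ \in _); rewrite ?normr1 ?normr0.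
Qed.

Lemma bounded_Omega_expR f : bounded_Omega f -> bounded_Omega (fun x =>
  expR (f x)).
Proof.
move=> [mf [K fK]]; split; first exact: (measurableT_comp (@measurable_expR R)
  mf).
exists (expR K) => x Ox.
by rewrite ger0_norm ?expR_ge0// ler_expR (le_trans (ler_norm _))// fK.
Qed.

Lemma bounded_Omega_smooth1 phi k : summable_fun leb phi ->
  bounded_Omega (fun x => smooth1 phi (tnth x k)).
Proof.
move=> phii; split.
  exact: measurableT_comp (measurable_smooth1 phii) (measurable_tnth _).
by exists (M2 * \int[leb]_t `|phi t|) => x _; exact: smooth1_bounded.
Qed.

Lemma bounded_Omega_kernel t k : bounded_Omega (fun x => s t (tnth x k)).
Proof.
split; first exact: measurableT_comp (measurable_kernel2 t) (measurable_tnth _).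
by exists M2 => x _; rewrite kernel_norm kernel_leM2.
Qed.

(** On [Omega] the logarithm is [L], a constant plus bounded smoothed terms. Outside, [Nsm] is 0 and
    [ln 0 = 0], so multiplying by the indicator gives formulas valid everywhere, whence
    measurability. *)
Lemma bounded_Omega_Nsm theta q f : separable theta q f ->
  bounded_Omega (Nsm a b s f) /\ bounded_Omega (fun x => ln (Nsm a b s f x)).
Proof.
move=> sf.
pose L x := ln theta + \sum_(k < r) smooth1 (fun t => ln (q k t)) (tnth x k).
have bL : bounded_Omega L.
  apply: bounded_OmegaD; first exact: bounded_Omega_cst.
  by apply: bounded_Omega_sum => k;
    exact/bounded_Omega_smooth1/(sep_summable_ln sf).
split.
  rewrite (_ : Nsm a b s f = fun x => \1_Om x * expR (L x)).
    exact: bounded_OmegaM bounded_Omega_indic (bounded_Omega_expR bL).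
  apply/funext => x; rewrite indicE; have [Ox|Ox] := pselect (Om x).
    by rewrite mem_set// mul1r (Nsm_in sf).
  by rewrite memNset// Nsm_out// mul0r.
rewrite (_ : (fun x => _) = fun x => \1_Om x * L x).
  exact: bounded_OmegaM bounded_Omega_indic bL.
apply/funext => x; rewrite indicE; have [Ox|Ox] := pselect (Om x).
  by rewrite mem_set// mul1r (ln_Nsm sf).
by rewrite memNset// Nsm_out// mul0r ln0.
Qed.

End kernel.
Arguments bounded_Omega_cst {R r a b} c.

(** Nonnegativity of the divergence between the weights [N j / S] and [N' j / S']: the tangent
    inequality at their ratio, multiplied by [N j / S], gives [key], and the differences of weights
    sum to [1 - 1]. *)
Lemma ln_sum_ge (R : realType) (m : nat) (N N' : 'I_m -> R) :
  (0 < m)%N -> (forall j, 0 < N j) -> (forall j, 0 < N' j) ->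
  \sum_(j < m) N j / (\sum_(i < m) N i) * (ln (N' j) - ln (N j)) <=
  ln (\sum_(j < m) N' j) - ln (\sum_(j < m) N j).
Proof.
case: m N N' => // m N N' _ N0 N'0.
have sum_gt0 (F : 'I_m.+1 -> R) : (forall j, 0 < F j) -> 0 < \sum_(j < m.+1) F
  j.
  move=> F0; rewrite (bigD1 ord0)//= ltr_wpDr// sumr_ge0// => j _; exact/ltW.
set S := \sum_(i < m.+1) N i; set S' := \sum_(j < m.+1) N' j.
have S0 : 0 < S by exact: sum_gt0.
have S'0 : 0 < S' by exact: sum_gt0.
have wE : \sum_(j < m.+1) N j / S = 1.
  by rewrite -mulr_suml mulfV// gt_eqF.
have w'E : \sum_(j < m.+1) N' j / S' = 1.
  by rewrite -mulr_suml mulfV// gt_eqF.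
have key j : N j / S * (ln (N' j) - ln (N j)) <=
    (N' j / S' - N j / S) + N j / S * (ln S' - ln S).
  have h : ln ((N' j / S') / (N j / S)) <= (N' j / S') / (N j / S) - 1.
    by rewrite ln_le_subr1// !divr_gt0.
  have w0 : 0 < N j / S by rewrite divr_gt0.
  have := ler_wpM2l (ltW w0) h.
  rewrite mulrBr mulr1 [_ * (_ / _)]mulrC divfK ?gt_eqF//.
  rewrite !ln_div ?posrE ?divr_gt0//.
  move: (ln _) (ln _) (ln _) (ln _) => A1 A2 A3 A4; lra.
apply: (le_trans (ler_sum _ (fun j _ => key j))).
by rewrite big_split/= sumrB wE w'E subrr add0r -mulr_suml wE mul1r.
Qed.

(** * One update step for an abstract average *)

Section update.
Context (R : realType) (r : nat) (a b : R) (s : R -> R -> R) (M1 M2 B : R).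
Hypothesis kern : smoothing_kernel a b s M1 M2 B.
Local Notation leb := (@lebesgue_measure R).
Local Notation mu := (lebesgue_tuple R r).
Local Notation Om := (@Omega R r a b).
Local Notation bO := (@bounded_Omega R r a b).
Local Notation sep := (@separable R r a b).

(** Each factor satisfies [ln (q k t) <= q k t], which is integrable; from below, (vi) bounds the
    whole product by a positive constant, and freezing all the other coordinates passes this bound
    to one factor. *)
Lemma candidate_separable m (e : 'I_m -> Rtuple R r -> R) j :
  a < b -> candidate a b M1 e -> exists theta q, sep theta q (e j).
Proof.
move=> ab [pc bb]; have [theta [q [theta0 qi q0 qo qE]]] := pc j.
exists theta, q; split => //.
have aab : a \in `[a, b] by rewrite in_itv/= lexx ltW.
have e0 x : Om x -> 0 < e j x.
  by move=> Ox; rewrite qE mulr_gt0// prodr_gt0// => k _; exact/q0/Ox.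
have M1r : 0 < M1 ^+ r by rewrite exprn_gt0// (kernel_M1_gt0 kern).
(* A corner of the cube: (vi) at this point forces the total mass to be positive. *)
pose x0 : Rtuple R r := [tuple a | _ < r].
have Ox0 : Om x0 by move=> k; rewrite tnth_mktuple.
pose c := M1 ^+ r * \int[mu]_z e j z.
have I0 : 0 < \int[mu]_z e j z.
  have := lt_le_trans M1r (bb j x0 Ox0).
  by rewrite pmulr_rgt0 ?e0// invr_gt0.
have c0 : 0 < c by rewrite mulr_gt0.
have ce x : Om x -> c <= e j x.
  by move=> Ox; rewrite -ler_pdivlMr//; exact: bb.
move=> k.
(* The value of everything but the [k]-th factor when the other coordinates are frozen at [a]. *)
pose P := theta * \prod_(l < r | l != k) q l a.
have P0 : 0 < P by rewrite mulr_gt0// prodr_gt0// => l _; exact: q0.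
have qc t : t \in `[a, b] -> c / P <= q k t.
  move=> tab; pose x : Rtuple R r := [tuple if l == k then t else a | l < r].
  have Ox : Om x by move=> l; rewrite tnth_mktuple; case: ifP.
  rewrite ler_pdivrMr//; apply: (le_trans (ce _ Ox)).
  rewrite qE (bigD1 k)//= tnth_mktuple eqxx /P mulrCA.
  rewrite (eq_bigr (fun l => q l a))// => l /negPf lk.
  by rewrite tnth_mktuple lk.
apply: (le_summable_fun _ _
  (summable_funD (qi k) (summable_funZl `|ln (c / P)| (summable_ind_ab a b)))).
  exact: measurableT_comp (@measurable_ln R) (summable_fun_measurable (qi k)).
move=> t; have [tab|tab] := boolP (t \in `[a, b]); last first.
  by rewrite qo// ind_ab_notin// ln0// normr0 mulr0 addr0.
rewrite ind_ab_in// mulr1.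
have qt := q0 k t tab.
have h1 : ln (q k t) <= q k t by exact/ltW/ln_sublinear.
have h2 : ln (c / P) <= ln (q k t).
  by rewrite ler_ln ?posrE ?qc// divr_gt0.
have h3 : - ln (c / P) <= `|ln (c / P)| by rewrite -normrN ler_norm.
have h4 : 0 <= `|ln (c / P)| by [].
by rewrite ler_norml; apply/andP; split; lra.
Qed.

(** What the target mean and the sample mean have in common. Concentration on [Omega] is encoded in
    [avg_le], which compares integrands only there. *)
Record averaging (I : (Rtuple R r -> R) -> R) : Prop := Averaging {
  avgD : forall c f g, bO f -> bO g ->
    I (fun x => c * f x + g x) = c * I f + I g;
  avg_le : forall f g, bO f -> bO g -> (forall x, Om x -> f x <= g x) ->
    I f <= I g;
  avg1 : I (fun=> 1) = 1;
  measurable_avg : forall w k, bO w -> measurable_fun setT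
    (fun t : measurableTypeR R => I (fun x => w x * s t (tnth x k)));
  avg_Fubini : forall w k phi, bO w -> summable_fun leb phi ->
    I (fun x => w x * smooth1 s phi (tnth x k)) =
    \int[leb]_t (I (fun x => w x * s t (tnth x k)) * phi t)
}.

Section averaging.
Variable I : (Rtuple R r -> R) -> R.
Hypothesis avg : averaging I.

Lemma avg0 : I (fun=> 0) = 0.
Proof.
have b1 := @bounded_Omega_cst R r a b 1.
have := avgD avg (-1) b1 b1; rewrite (avg1 avg).
by rewrite (_ : (fun=> _) = fun=> 0); [move=> ->; ring|apply/funext => x; ring].
Qed.

Lemma avgZ c f : bO f -> I (fun x => c * f x) = c * I f.
Proof.
move=> bf; have := avgD avg c bf (bounded_Omega_cst 0).
rewrite avg0 addr0 => <-; congr I; apply/funext => x; by rewrite addr0.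
Qed.

Lemma avg_add f g : bO f -> bO g -> I (fun x => f x + g x) = I f + I g.
Proof.
move=> bf bg; have := avgD avg 1 bf bg; rewrite mul1r => <-; congr I.
by apply/funext => x; rewrite mul1r.
Qed.

Lemma avg_sum (J : Type) (l : seq J) (F : J -> Rtuple R r -> R) :
  (forall j, bO (F j)) ->
  I (fun x => \sum_(j <- l) F j x) = \sum_(j <- l) I (F j).
Proof.
move=> bF; elim: l => [|j l IH].
  by rewrite big_nil -[RHS]avg0; congr I; apply/funext => x; rewrite big_nil.
rewrite big_cons -IH -avg_add//; last exact: bounded_Omega_sum.
by congr I; apply/funext => x; rewrite big_cons.
Qed.

(** By antisymmetry from [avg_le]; it allows formulas for [ln (Nsm _)] that hold only on [Omega] to
    be substituted inside [I]. *)
Lemma eq_avg f g : bO f -> bO g -> (forall x, Om x -> f x = g x) -> I f = I g.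
Proof.
move=> bf bg fg; apply/eqP; rewrite eq_le.
by apply/andP; split; apply: (avg_le avg) => // x /fg ->.
Qed.

(** The [k]-th marginal density of [A_j] when [w] is the weight: the other kernel factors integrate
    to 1. *)
Definition marginal (w : Rtuple R r -> R) k t := I (fun x =>
  w x * s t (tnth x k)).

(** All [r] marginals have mass [I w], so this power in the denominator normalizes the product to
    mass [I w] as well. *)
Definition marginal_product (w : Rtuple R r -> R) (u : Rtuple R r) : R :=
  (\prod_(k < r) marginal w k (tnth u k)) / I w ^+ r.-1.

Section update.
Variables (w : Rtuple R r -> R) (delta : R).
Hypothesis r_gt0 : (0 < r)%N.
Hypotheses (bw : bO w) (delta0 : 0 < delta) (w_ge : forall x, Om x -> delta <=
  w x).

(** An average transports only weak inequalities, so strict positivity comes from the uniform bound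
    [delta]. *)
Lemma mass_gt0 : 0 < I w.
Proof.
have b1 := @bounded_Omega_cst R r a b 1.
have bd := @bounded_Omega_cst R r a b delta.
apply: (lt_le_trans delta0); have := avg_le avg bd bw w_ge; apply: le_trans.
by have := avgZ delta b1; rewrite (avg1 avg) !mulr1 => ->.
Qed.

Lemma marginal_out k t : t \notin `[a, b] -> marginal w k t = 0.
Proof.
move=> tab; rewrite -[RHS]avg0; congr I; apply/funext => x.
by rewrite (kernel_out1 kern)// mulr0.
Qed.

(** The kernel bound passes through the average. Together with the upper bound by [M2], it keeps the
    logarithms of the factors of the update bounded. *)
Lemma marginal_ge k t : t \in `[a, b] -> M1 * I w <= marginal w k t.
Proof.
move=> tab; rewrite -avgZ//; apply: (avg_le avg).
- exact: bounded_OmegaM (bounded_Omega_cst _) bw.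
- exact: bounded_OmegaM bw (bounded_Omega_kernel kern t k).
- move=> x Ox; rewrite mulrC ler_wpM2l//.
    by rewrite (le_trans (ltW delta0))// w_ge.
  by have /andP[] := kernel_bounds kern tab (Ox k).
Qed.

Lemma marginal_le k t : marginal w k t <= M2 * I w.
Proof.
rewrite -avgZ//; apply: (avg_le avg).
- exact: bounded_OmegaM bw (bounded_Omega_kernel kern t k).
- exact: bounded_OmegaM (bounded_Omega_cst _) bw.
- move=> x Ox; rewrite mulrC ler_wpM2r//.
    by rewrite (le_trans (ltW delta0))// w_ge.
  exact: (kernel_leM2 kern).
Qed.

Lemma marginal_gt0 k t : t \in `[a, b] -> 0 < marginal w k t.
Proof.
move=> tab; apply: lt_le_trans (marginal_ge k tab).
by rewrite mulr_gt0 ?mass_gt0 ?(kernel_M1_gt0 kern).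
Qed.

Lemma marginal_ge0 k t : 0 <= marginal w k t.
Proof.
have [tab|tab] := boolP (t \in `[a, b]); last by rewrite marginal_out.
exact/ltW/marginal_gt0.
Qed.

Lemma summable_marginal k : summable_fun leb (marginal w k).
Proof.
apply: (le_summable_fun _ _ (summable_funZl (M2 * I w) (summable_ind_ab a b))).
  exact: (measurable_avg avg).
move=> t; rewrite ger0_norm ?marginal_ge0//.
have [tab|tab] := boolP (t \in `[a, b]); last by rewrite marginal_out//
  ind_ab_notin ?mulr0.
by rewrite ind_ab_in// mulr1 marginal_le.
Qed.

Lemma summable_marginalM k phi : summable_fun leb phi ->
  summable_fun leb (fun t => marginal w k t * phi t).
Proof.
move=> phii; apply: (le_summable_fun _ _ (summable_funZl (M2 * I w)
  (summable_fun_norm phii))).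
  apply: measurable_funM; first exact: (measurable_avg avg).
  exact: (summable_fun_measurable phii).
by move=> t; rewrite normrM ler_wpM2r// ger0_norm ?marginal_ge0 ?marginal_le.
Qed.

Lemma marginal_product_separable : sep (I w ^- r.-1) (marginal w)
  (marginal_product w).
Proof.
split.
- by rewrite invr_gt0 exprn_gt0// mass_gt0.
- exact: summable_marginal.
- exact: marginal_gt0.
- exact: marginal_out.
- move=> k; pose K := `|ln (M1 * I w)| + `|ln (M2 * I w)|.
  apply: (le_summable_fun _ _ (summable_funZl K (summable_ind_ab a b))).
    apply: measurableT_comp (@measurable_ln R) _; exact: (measurable_avg avg).
  move=> t; have [tab|tab] := boolP (t \in `[a, b]); last first.
    by rewrite marginal_out// ind_ab_notin// ln0// normr0 mulr0.
  rewrite ind_ab_in// mulr1 /K.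
  have h1 : ln (M1 * I w) <= ln (marginal w k t).
    by rewrite ler_ln ?posrE ?marginal_ge ?marginal_gt0//
      mulr_gt0 ?mass_gt0 ?(kernel_M1_gt0 kern).
  have h2 : ln (marginal w k t) <= ln (M2 * I w).
    by rewrite ler_ln ?posrE ?marginal_le ?marginal_gt0//
      mulr_gt0 ?mass_gt0 ?(kernel_M2_gt0 kern).
  have h3 : - ln (M1 * I w) <= `|ln (M1 * I w)| by rewrite -normrN ler_norm.
  have h4 : ln (M2 * I w) <= `|ln (M2 * I w)| by rewrite ler_norm.
  have h5 : 0 <= `|ln (M1 * I w)| by [].
  have h6 : 0 <= `|ln (M2 * I w)| by [].
  by rewrite ler_norml; apply/andP; split; lra.
- by move=> u; rewrite /marginal_product mulrC.
Qed.

(** [avg_Fubini] with the indicator of [[a, b]] as [phi]: by the normalization of the kernel, its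
    smoothing is 1 at every coordinate of a point of [Omega]. *)
Lemma Rintegral_marginal k : \int[leb]_t marginal w k t = I w.
Proof.
have indi := summable_ind_ab a b.
transitivity (I (fun x => w x * smooth1 s (ind_ab a b) (tnth x k))); last first.
  apply: eq_avg => //.
    exact: bounded_OmegaM bw (bounded_Omega_smooth1 kern k indi).
  move=> x Ox; rewrite (_ : smooth1 _ _ _ = 1) ?mulr1//
    -(Rintegral_kernel kern (Ox k)).
  apply: eq_Rintegral => t _; have [tab|tab] := boolP (t \in `[a, b]).
    by rewrite ind_ab_in// mulr1.
  by rewrite (kernel_out1 kern)// mul0r.
rewrite (avg_Fubini avg)//; apply: eq_Rintegral => t _.
have [tab|tab] := boolP (t \in `[a, b]); first by rewrite ind_ab_in// mulr1.
by rewrite -/(marginal w k t) marginal_out// mul0r.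
Qed.

Section divergence.
Variables (theta : R) (q : 'I_r -> R -> R) (f : Rtuple R r -> R).
Hypothesis sf : sep theta q f.

Let D (k : 'I_r) t := ln (marginal w k t) - ln (q k t).

Let Di k : summable_fun leb (D k).
Proof.
exact: summable_funB (sep_summable_ln marginal_product_separable k)
  (sep_summable_ln sf k).
Qed.

Let C := ln (I w ^- r.-1) - ln theta.

(** The splitting of the log ratio into [C] and the [D k] is valid on [Omega]; the prefactor
    vanishes elsewhere, which makes the identity global. *)
Let log_ratio_integrand u : marginal_product w u * (ln (marginal_product w u) -
  ln (f u)) =
  (I w ^- r.-1) * ((\prod_(k < r) marginal w k (tnth u k)) *
    (C + \sum_(k < r) D k (tnth u k))).
Proof.
rewrite {1}/marginal_product; have [Ou|Ou] := pselect (Om u).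
  rewrite (separable_ln marginal_product_separable)// (separable_ln sf)//
    /D sumrB /C.
  ring.
by rewrite -/(marginal_product w u) (separable_out
  marginal_product_separable)// mul0r mulrA
   -(sepE marginal_product_separable) (separable_out
     marginal_product_separable)// mul0r.
Qed.

Lemma summable_log_ratio :
  summable_fun mu (fun u => marginal_product w u * (ln (marginal_product w u) -
    ln (f u))).
Proof.
have [h _] := lebesgue_tuple_prod_sum C (sep_summable
  marginal_product_separable)
  (fun k => summable_marginalM k (Di k)).
by apply: (eq_summable_fun _ (summable_funZl (I w ^- r.-1) h)) => u;
  rewrite log_ratio_integrand.
Qed.

(* Both sides equal [C * I w + \sum_k \int marginal w k * D k], since
   [ln (marginal_product w) - ln f] is a sum of functions of one coordinate and
   [marginal_product w] has the same one-dimensional marginals as the smoothed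
   weight. *)
Lemma avg_log_ratio :
  I (fun x => w x * (ln (Nsm a b s (marginal_product w) x) - ln (Nsm a b s f
    x))) =
  \int[mu]_u (marginal_product w u * (ln (marginal_product w u) - ln (f u))).
Proof.
transitivity (C * I w + \sum_(k < r) \int[leb]_t (marginal w k t * D k t)).
  have bD k : bO (fun x => w x * smooth1 s (D k) (tnth x k)).
    exact: bounded_OmegaM bw (bounded_Omega_smooth1 kern k (Di k)).
  transitivity (I (fun x => C * w x + \sum_(k < r) w x * smooth1 s (D k) (tnth
    x k))).
    apply: eq_avg.
    - apply: bounded_OmegaM => //; apply: bounded_OmegaB.
        exact: (bounded_Omega_Nsm kern marginal_product_separable).2.
      exact: (bounded_Omega_Nsm kern sf).2.
    - apply: bounded_OmegaD; last exact: bounded_Omega_sum.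
      exact: bounded_OmegaM (bounded_Omega_cst _) bw.
    - move=> x Ox; rewrite (ln_Nsm kern marginal_product_separable)//
        (ln_Nsm kern sf)//.
      rewrite -mulr_sumr [C * _]mulrC -mulrDr; congr (_ * _).
      rewrite opprD addrACA; congr (_ + _); rewrite -sumrB;
        apply: eq_bigr => k _.
      rewrite /smooth1 -RintegralB//.
      + by apply: eq_Rintegral => t _; rewrite /D mulrBr.
      + exact: (summable_smooth1 kern (sep_summable_ln
          marginal_product_separable k)).
      + exact: (summable_smooth1 kern (sep_summable_ln sf k)).
  rewrite (avgD avg)//; last exact: bounded_Omega_sum.
  rewrite avg_sum//; congr (_ + _); apply: eq_bigr => k _.
  by rewrite (avg_Fubini avg).
have [h1 h2] := lebesgue_tuple_prod_sum C (sep_summable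
  marginal_product_separable)
  (fun k => summable_marginalM k (Di k)).
under [RHS]eq_Rintegral do rewrite log_ratio_integrand.
have c0 : I w != 0 by rewrite gt_eqF// mass_gt0.
(* Positivity of [r] matters here: the predecessor is truncated, and for [r = 0] the left side would
   be 1 instead of [I w]. *)
have cr : I w ^+ r = I w * I w ^+ r.-1 by rewrite -exprS prednK.
have d0 : I w ^+ r.-1 != 0 by rewrite expf_neq0.
rewrite RintegralZl// h2 mulrDr; congr (_ + _).
  under eq_bigr do rewrite Rintegral_marginal.
  by rewrite prodr_const card_ord cr; field.
rewrite mulr_sumr; apply: eq_bigr => k _.
under [X in _ = _ * (_ * X)]eq_bigr do rewrite Rintegral_marginal.
rewrite prodr_const; set x := (\int[_]__ _).
(* Omitting coordinate [k] leaves [r.-1] masses, which cancel the normalizing power. *)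
rewrite (_ : #|_| = r.-1); first by field.
by rewrite cardC1 card_ord.
Qed.

(** The infinite branch of [xlog] is never met: both functions are positive on [Omega], and outside
    it the first one vanishes. *)
Lemma KL_marginal_product : KL (marginal_product w) f =
  ((\int[mu]_u (marginal_product w u * (ln (marginal_product w u) - ln (f u))))
   + (\int[mu]_u f u - \int[mu]_u marginal_product w u))%:E.
Proof.
have fi := separable_summable sf; have ui := separable_summable
  marginal_product_separable.
rewrite -RintegralB// -RintegralD//; last 2 first.
  exact: summable_log_ratio.
  exact: summable_funB.
rewrite summable_fun_fineK; last exact: summable_funD summable_log_ratio
  (summable_funB fi ui).
apply: eq_integral => u _; rewrite [in RHS]EFinD; congr (_ + _)%E.
rewrite /xlog; have [Ou|Ou] := pselect (Om u).
  have f0 := separable_gt0 sf Ou; have u0 := separable_gt0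
    marginal_product_separable Ou.
  by rewrite !gt_eqF// ln_div.
by rewrite (separable_out marginal_product_separable)// eqxx mul0r.
Qed.

End divergence.
End update.

(** * Weights of a mixture and the descent inequality *)

Section descent.
Variables (m : nat) (e : 'I_m -> Rtuple R r -> R).
Hypotheses (r_gt0 : (0 < r)%N) (m_gt0 : (0 < m)%N).
Hypothesis se : forall j, exists theta q, sep theta q (e j).

Let N_gt0 j x : Om x -> 0 < Nsm a b s (e j) x.
Proof. by have [theta [q sj]] := se j; exact: (Nsm_gt0 kern sj). Qed.

Let bN j : bO (Nsm a b s (e j)).
Proof. by have [theta [q sj]] := se j; exact: (bounded_Omega_Nsm kern sj).1.
  Qed.

Let bL j : bO (fun x => ln (Nsm a b s (e j) x)).
Proof. by have [theta [q sj]] := se j; exact: (bounded_Omega_Nsm kern sj).2.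
  Qed.

Lemma Nsm_le_Nsum j x : Om x -> Nsm a b s (e j) x <= Nsum a b s e x.
Proof.
move=> Ox; rewrite /Nsum (bigD1 j)//= lerDl sumr_ge0// => i _.
exact/ltW/N_gt0.
Qed.

Lemma Nsum_gt0 x : Om x -> 0 < Nsum a b s e x.
Proof.
move=> Ox; apply: lt_le_trans (Nsm_le_Nsum (Ordinal m_gt0) Ox).
exact: N_gt0.
Qed.

Lemma bounded_Omega_Nsum : bO (Nsum a b s e).
Proof. exact: bounded_Omega_sum. Qed.

(** From above by [ln x <= x], from below by the logarithm of a single component, which exists since
    [m] is positive. *)
Lemma bounded_Omega_ln_Nsum : bO (fun x => ln (Nsum a b s e x)).
Proof.
have [mS [K SK]] := bounded_Omega_Nsum.
have [_ [K' LK']] := bL (Ordinal m_gt0).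
split; first exact: measurableT_comp (@measurable_ln R) mS.
exists (K + K') => x Ox.
have S0 := Nsum_gt0 Ox.
have h1 : ln (Nsum a b s e x) <= Nsum a b s e x by exact/ltW/ln_sublinear.
have h2 : ln (Nsm a b s (e (Ordinal m_gt0)) x) <= ln (Nsum a b s e x).
  by rewrite ler_ln ?posrE ?N_gt0// Nsm_le_Nsum.
have := SK x Ox; have := LK' x Ox; rewrite !ler_norml.
by move=> /andP[? ?] /andP[? ?]; apply/andP; split; lra.
Qed.

(** Written as the exponential of a bounded function, a weight is seen at once to be bounded and
    bounded away from 0 on [Omega]. *)
Lemma weight_in j x : Om x -> weight a b s e j x =
  expR (ln (Nsm a b s (e j) x) - ln (Nsum a b s e x)).
Proof.
move=> Ox; rewrite -ln_div ?posrE ?N_gt0 ?Nsum_gt0//.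
by rewrite lnK// posrE divr_gt0 ?N_gt0 ?Nsum_gt0.
Qed.

Lemma bounded_Omega_weight j : bO (weight a b s e j).
Proof.
have bd := bounded_OmegaB (bL j) bounded_Omega_ln_Nsum.
suff -> : weight a b s e j = fun x =>
    \1_Om x * expR (ln (Nsm a b s (e j) x) - ln (Nsum a b s e x)).
  exact: bounded_OmegaM (bounded_Omega_indic r a b) (bounded_Omega_expR bd).
apply/funext => x; rewrite indicE.
have [Ox|Ox] := pselect (Om x); first by rewrite mem_set// mul1r weight_in.
by rewrite memNset// /weight Nsm_out// !mul0r.
Qed.

Lemma weight_ge j : exists2 delta, 0 < delta &
  forall x, Om x -> delta <= weight a b s e j x.
Proof.
have [_ [K LK]] := bounded_OmegaB (bL j) bounded_Omega_ln_Nsum.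
exists (expR (- K)); first exact: expR_gt0.
move=> x Ox; rewrite weight_in// ler_expR.
by have := LK x Ox; rewrite ler_norml => /andP[].
Qed.

Lemma integral_sum_separable :
  (\int[mu]_x (\sum_(j < m) e j x)%R%:E = (\sum_(j < m) \int[mu]_x e j
    x)%R%:E)%E.
Proof.
have ei j : summable_fun mu (e j).
  by have [theta [q sj]] := se j; exact: separable_summable sj.
by rewrite -summable_fun_fineK; [rewrite Rintegral_sum|exact: summable_fun_sum].
Qed.

End descent.

Section one_step.
Variables (m : nat) (e : 'I_m -> Rtuple R r -> R).
Hypotheses (r_gt0 : (0 < r)%N) (m_gt0 : (0 < m)%N).
Hypothesis se : forall j, exists theta q, sep theta q (e j).

Let e' j := marginal_product (weight a b s e j).

Lemma marginal_product_weight_separable j : exists theta q, sep theta q (e' j).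
Proof.
have [delta d0 dw] := weight_ge m_gt0 se j.
eexists; eexists; apply: marginal_product_separable d0 dw => //.
exact: bounded_Omega_weight.
Qed.

(* [e1] stays a variable at the point of use: comparing [e'] with [e] by
   unfolding is intractable there. *)
Lemma descent e1 : e1 = e' -> (\sum_(j < m) KL (e1 j) (e j) <=
  (I (fun x => ln (Nsum a b s e1 x) - ln (Nsum a b s e x))
   + (\sum_(j < m) \int[mu]_x e j x - \sum_(j < m) \int[mu]_x e1 j x))%R%:E)%E.
Proof.
move=> ->.
have se' := marginal_product_weight_separable.
pose L j x := weight a b s e j x * (ln (Nsm a b s (e' j) x) - ln (Nsm a b s (e
  j) x)).
have bw := bounded_Omega_weight m_gt0 se.
have bL j : bO (L j).
  have [theta [q sj]] := se j; have [theta' [q' sj']] := se' j.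
  apply: bounded_OmegaM => //; apply: bounded_OmegaB.
    exact: (bounded_Omega_Nsm kern sj').2.
  exact: (bounded_Omega_Nsm kern sj).2.
have KLE j : KL (e' j) (e j) =
    (I (L j) + (\int[mu]_x e j x - \int[mu]_x e' j x))%:E.
  have [theta [q sj]] := se j; have [delta d0 dw] := weight_ge m_gt0 se j.
  by rewrite (KL_marginal_product (bw j) d0 dw sj) /L (avg_log_ratio r_gt0 (bw
    j) d0 dw sj).
(* The mass differences agree on both sides and cancel; what remains is the pointwise concavity
   inequality under [I]. *)
rewrite (eq_bigr _ (fun j _ => KLE j)) sumEFin lee_fin big_split/= sumrB lerD2r.
rewrite -avg_sum//; apply: (avg_le avg).
- exact: bounded_Omega_sum.
- by apply: bounded_OmegaB; apply: bounded_Omega_ln_Nsum.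
- move=> x Ox; apply: ln_sum_ge => // j.
    by have [theta [q sj]] := se j; exact: (Nsm_gt0 kern sj Ox).
  by have [theta [q sj]] := se' j; exact: (Nsm_gt0 kern sj Ox).
Qed.

End one_step.
End averaging.
End update.

(** Subtraction of extended values is informative only for finite [o], hence the companion additive
    form, which remains meaningful at [+oo]. *)
Lemma descent_objectives (R : realType) (o o' k : \bar R) (l d t t' : R) :
  o = (l + t)%:E -> o' = (l - d + t')%:E -> (k <= (d + (t - t'))%:E)%E ->
  (o \is a fin_num -> (k <= o - o')%E) /\ (o' + k <= o)%E.
Proof.
move=> -> -> kd; split=> [_|].
  by apply: (le_trans kd); rewrite -EFinB lee_fin; lra.
by apply: (le_trans (leeD2l _ kd)); rewrite -EFinD lee_fin; lra.
Qed.

(** * The sample mean and the target mean as averages, and the two objectives *)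

Section instances.
Context (R : realType) (r : nat) (a b : R) (s : R -> R -> R) (M1 M2 B : R).
Hypothesis kern : smoothing_kernel a b s M1 M2 B.
Local Notation leb := (@lebesgue_measure R).
Local Notation mu := (lebesgue_tuple R r).
Local Notation Om := (@Omega R r a b).
Local Notation bO := (@bounded_Omega R r a b).

Section empirical.
Variables (n : nat) (X : 'I_n -> Rtuple R r).
Hypotheses (n_gt0 : (0 < n)%N) (X_in : forall i, Om (X i)).

Definition empirical_mean (f : Rtuple R r -> R) : R :=
  \sum_(i < n) n%:R^-1 * f (X i).

Lemma averaging_empirical_mean : averaging a b s empirical_mean.
Proof.
have n0 : (n%:R : R) != 0 by rewrite pnatr_eq0 -lt0n.
split.
- move=> c f g _ _; rewrite /empirical_mean mulr_sumr -big_split/=.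
  by apply: eq_bigr => i _; ring.
- move=> f g _ _ fg; apply: ler_sum => i _.
  by rewrite ler_wpM2l ?invr_ge0// fg.
- by rewrite /empirical_mean sumr_const card_ord mulr1 -[LHS]mulr_natl mulfV.
- move=> w k _; apply: measurable_sum => i.
  apply: measurable_funM; first exact: measurable_cst.
  apply: measurable_funM; first exact: measurable_cst.
  exact: (measurable_kernel1 kern).
- move=> w k phi _ phii; rewrite /empirical_mean.
  under [RHS]eq_Rintegral do rewrite mulr_suml.
  have si i := summable_smooth1 kern phii (tnth (X i) k).
  have E i t : (n%:R^-1 * w (X i)) * (s t (tnth (X i) k) * phi t) =
      n%:R^-1 * (w (X i) * s t (tnth (X i) k)) * phi t by ring.
  rewrite Rintegral_sum => [|i]; last first.
    by apply: (eq_summable_fun _ (summable_funZl (n%:R^-1 * w (X i)) (si i)))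
      => t; rewrite E.
  apply: eq_bigr => i _; under [RHS]eq_Rintegral do rewrite -E.
  by rewrite RintegralZl; [rewrite mulrA|by []|exact: si].
Qed.

End empirical.

Section density.
Variable g : Rtuple R r -> R.
Hypothesis gtarget : target_density a b g.

Lemma target_ge0 x : 0 <= g x. Proof. by case: gtarget => -[_ + _] _;
  apply. Qed.

(** The support lives in row vectors: a point with [g x != 0] has its row in the image of [Omega],
    and injectivity of [row_of] brings it back to [Omega]. *)
Lemma target_out x : ~ Om x -> g x = 0.
Proof.
move=> Ox; apply/eqP/negPn/negP => gx; apply: Ox.
have [_ /(_ (row_of x)) h] := gtarget.
have /interior_subset [y Oy yx] : (@row_of R r @` Om)° (row_of x).
  by apply: h; apply: subset_closure; exists x.
suff -> : x = y by [].
apply: eq_from_tnth => k.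
by have /rowP/(_ k) := yx; rewrite !mxE.
Qed.

Lemma summable_target : summable_fun mu g.
Proof.
have [[mg g0 g1] _] := gtarget; apply/integrableP; split;
  first exact/measurable_EFinP.
under eq_integral => x _ do rewrite gee0_abs ?lee_fin//.
by rewrite g1 ltry.
Qed.

Lemma summable_targetM f : bO f -> summable_fun mu (fun x => g x * f x).
Proof.
move=> [mf [K fK]]; apply: (le_summable_fun _ _ (summable_funZl K
  summable_target)).
  apply: measurable_funM => //; exact: (summable_fun_measurable
    summable_target).
move=> x; have [Ox|Ox] := pselect (Om x); last by rewrite target_out//
  mul0r normr0 mulr0.
by rewrite normrM (ger0_norm (target_ge0 x)) mulrC ler_wpM2r ?target_ge0 ?fK.
Qed.

Definition target_mean f : R := \int[mu]_x (g x * f x).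

Lemma summable_target_kernel w k phi : bO w -> summable_fun leb phi ->
  summable_fun (mu \x leb)%E
    (fun p => g p.1 * (w p.1 * s p.2 (tnth p.1 k)) * phi p.2).
Proof.
move=> bw phii; have gw := summable_targetM bw.
have gi := summable_fun_measurable summable_target.
have phim := summable_fun_measurable phii.
apply: (le_summable_fun _ _ (summable_fun_prod (summable_fun_norm gw)
  (summable_funZl M2 (summable_fun_norm phii)))).
  apply: measurable_funM; last exact: measurableT_comp phim measurable_snd.
  apply: measurable_funM; first exact: measurableT_comp gi measurable_fst.
  apply: measurable_funM; first exact: measurableT_comp bw.1 measurable_fst.
  have mt : measurable_fun setT (fun p : Rtuple R r * measurableTypeR R =>
    tnth p.1 k).
    exact: measurableT_comp (measurable_tnth k) measurable_fst.
  have := measurableT_comp (measurable_kernel kern) (measurable_fun_pair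
    measurable_snd mt).
  exact.
move=> p; rewrite mulrA -mulrA !normrM (kernel_norm kern) ler_wpM2l ?mulr_ge0//.
by rewrite ler_wpM2r// (kernel_leM2 kern).
Qed.

Lemma averaging_target_mean : averaging a b s target_mean.
Proof.
split.
- move=> c f h bf bh; rewrite /target_mean -RintegralZl//;
    last exact: summable_targetM.
  rewrite -RintegralD//; last 2 first.
  + exact/summable_funZl/summable_targetM.
  + exact: summable_targetM.
  by apply: eq_Rintegral => x _; ring.
- move=> f h bf bh fh; apply: le_Rintegral => //.
  + exact: summable_targetM.
  + exact: summable_targetM.
  + move=> x _; have [Ox|Ox] := pselect (Om x); last by rewrite target_out//
      !mul0r.
    by rewrite ler_wpM2l ?target_ge0 ?fh.
- rewrite /target_mean; under eq_Rintegral do rewrite mulr1.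
  by have [[_ _ g1] _] := gtarget; rewrite /Rintegral g1.
- move=> w k bw.
  (* Measurability in [t] is read off from joint integrability, which needs an integrable factor in
     [t]; the indicator is inserted at no cost because the kernel vanishes off [[a, b]]. *)
  have h := measurable_Rintegral1
    (f := fun x (t : measurableTypeR R) => g x * (w x * s t (tnth x k)) *
      ind_ab a b t)
    (summable_target_kernel k bw (summable_ind_ab a b)).
  rewrite (_ : (fun t => _) =
    fun t => \int[mu]_x (g x * (w x * s t (tnth x k)) * ind_ab a b t))//.
  apply/funext => t; apply: eq_Rintegral => x _.
  have [tab|tab] := boolP (t \in `[a, b]); first by rewrite ind_ab_in// mulr1.
  by rewrite (kernel_out1 kern)// !(mulr0, mul0r).
- move=> w k phi bw phii.
  have gws t : summable_fun mu (fun x => g x * (w x * s t (tnth x k))).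
    by apply/summable_targetM/bounded_OmegaM => //;
      exact: (bounded_Omega_kernel kern).
  have E x t : g x * (w x * s t (tnth x k)) * phi t =
    (g x * w x) * (s t (tnth x k) * phi t) by ring.
  have ss x : summable_fun leb (fun t => s t (tnth x k) * phi t).
    exact: (summable_smooth1 kern).
  transitivity (\int[mu]_x \int[leb]_t (g x * (w x * s t (tnth x k)) * phi t)).
    apply: eq_Rintegral => x _; under [RHS]eq_Rintegral do rewrite E.
    by rewrite RintegralZl; [rewrite mulrA|by []|exact: ss].
  rewrite Rintegral_Fubini.
  + by apply: eq_Rintegral => t _; rewrite RintegralZr; [|by []|exact: gws].
  + exact: summable_target_kernel.
  + move=> x; apply: (eq_summable_fun _ (summable_funZl (g x * w x) (ss x))) =>
      t.
    by rewrite E.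
  + move=> t; apply: (eq_summable_fun _ (summable_funZl (phi t) (gws t))) => x.
    by rewrite mulrC.
Qed.

Section objective.
Variables (m : nat) (m_gt0 : (0 < m)%N).
Implicit Type e : 'I_m -> Rtuple R r -> R.

Definition log_loss e x : R := g x * (ln (g x) - ln (Nsum a b s e x)).

Let sepm e := forall j, exists theta q, separable a b theta q (e j).

Lemma xlog_target e x : sepm e -> xlog (g x) (Nsum a b s e x) =
  (log_loss e x)%:E.
Proof.
move=> se; rewrite /xlog /log_loss.
have [gx|gx] := eqVneq (g x) 0; first by rewrite gx mul0r.
have Ox : Om x by apply: contra_notP (negP gx) => /target_out ->.
have S0 := Nsum_gt0 kern m_gt0 se Ox.
by rewrite gt_eqF// ln_div// posrE lt_neqAle eq_sym gx target_ge0.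
Qed.

Lemma objectiveE e : sepm e -> summable_fun mu (log_loss e) ->
  objective a b s g e =
  (\int[mu]_x log_loss e x + \sum_(j < m) \int[mu]_x e j x)%:E.
Proof.
move=> se Fi; rewrite /objective (integral_sum_separable se) EFinD.
rewrite summable_fun_fineK//; congr (_ + _)%E.
by apply: eq_integral => x _; exact: xlog_target.
Qed.

(** The tangent inequality gives [g * ln (g / N) >= g - N >= - K] on [Omega], so the loss has an
    integrable lower bound. The indicator of the cube is written as a product of [ind_ab] to make
    its integrability immediate. *)
Lemma objective_dichotomy e : sepm e ->
  summable_fun mu (log_loss e) \/ objective a b s g e = +oo%E.
Proof.
move=> se; have [mS [K SK]] := bounded_Omega_Nsum kern se.
have mg := summable_fun_measurable summable_target.
have mF : measurable_fun setT (log_loss e).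
  apply: measurable_funM => //; apply: measurable_funB.
    exact: measurableT_comp (@measurable_ln R) mg.
  exact: measurableT_comp (@measurable_ln R) mS.
have [hi _] := lebesgue_tuple_prod (fun k : 'I_r => summable_ind_ab a b).
have lower x : - (K * \prod_(k < r) ind_ab a b (tnth x k)) <= log_loss e x.
  rewrite /log_loss; have [Ox|Ox] := pselect (Om x); last first.
    rewrite target_out// mul0r; have /existsNP[k /negP xk] := Ox.
    by rewrite (bigD1 k)//= ind_ab_notin// mul0r mulr0 oppr0.
  rewrite big1 ?mulr1; last by move=> k _; exact/ind_ab_in/Ox.
  have S0 := Nsum_gt0 kern m_gt0 se Ox.
  have SleK := SK x Ox; rewrite gtr0_norm// in SleK.
  have [gx|gx] := eqVneq (g x) 0; first by rewrite gx mul0r oppr_le0 (le_trans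
    (ltW S0)).
  have g0 : 0 < g x by rewrite lt_neqAle eq_sym gx target_ge0.
  have h : ln (Nsum a b s e x / g x) <= Nsum a b s e x / g x - 1.
    by rewrite ln_le_subr1// divr_gt0.
  have := ler_wpM2l (ltW g0) h.
  have -> : g x * (Nsum a b s e x / g x - 1) = Nsum a b s e x - g x by field.
  rewrite ln_div ?posrE// !mulrBr; lra.
have [|Foo] := summable_fun_or_pinfty mF (summable_funZl K hi) lower;
  [by left|right].
rewrite /objective (integral_sum_separable se).
under eq_integral => x _ do rewrite xlog_target//.
by rewrite Foo.
Qed.

Lemma G_update e : G a b s g e = fun j => marginal_product s target_mean
  (weight a b s e j).
Proof.
apply/funext => j; apply/funext => u; rewrite /G /marginal_product;
  congr (_ / _).
by apply: eq_bigr => k _; apply: eq_Rintegral => x _; rewrite mulrA.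
Qed.

Lemma descent_continuous e e' : (0 < r)%N -> sepm e -> e' = G a b s g e ->
  (objective a b s g e \is a fin_num ->
     \sum_(j < m) KL (e' j) (e j) <= objective a b s g e - objective a b s g
       e')%E
  /\ (objective a b s g e' + \sum_(j < m) KL (e' j) (e j) <= objective a b s g
    e)%E.
Proof.
rewrite G_update => r_gt0 se e'E.
have se' : sepm e'.
  by rewrite e'E => j; exact: (marginal_product_weight_separable kern
    averaging_target_mean).
(* With an infinite objective, the first claim has a false premise and the second is bounded by
   [+oo]. *)
have [Fi|->] := objective_dichotomy se; last by split; [|rewrite leey].
have bd : bO (fun x => ln (Nsum a b s e' x) - ln (Nsum a b s e x)).
  by apply: bounded_OmegaB; exact: (bounded_Omega_ln_Nsum kern).
(* The term [g * ln g] is common to both losses, which differ by [g] times a function bounded on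
   [Omega]; finiteness thus passes from [e] to [e']. *)
have F'E x : log_loss e x - g x * (ln (Nsum a b s e' x) - ln (Nsum a b s e x)) =
  log_loss e' x.
  have alg (c y z t : R) : c * (y - z) - c * (t - z) = c * (y - t) by ring.
  exact: (alg (g x) (ln (g x)) (ln (Nsum a b s e x)) (ln (Nsum a b s e' x))).
have F'i : summable_fun mu (log_loss e').
  by apply: (eq_summable_fun _ (summable_funB Fi (summable_targetM bd))) => x;
    rewrite F'E.
have F'I : \int[mu]_x log_loss e' x = \int[mu]_x log_loss e x -
    target_mean (fun x => ln (Nsum a b s e' x) - ln (Nsum a b s e x)).
  rewrite /target_mean -(RintegralB measurableT Fi (summable_targetM bd)).
  by apply: eq_Rintegral => x _; rewrite F'E.
have oE' := objectiveE se' F'i; rewrite F'I in oE'.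
apply: (descent_objectives (objectiveE se Fi) oE').
exact: (descent kern averaging_target_mean r_gt0 m_gt0 se e'E).
Qed.

End objective.
End density.

Section discrete.
Variables (n : nat) (X : 'I_n -> Rtuple R r) (m : nat).
Hypotheses (n_gt0 : (0 < n)%N) (X_in : forall i, Om (X i)) (m_gt0 : (0 < m)%N).
Variable e : 'I_m -> Rtuple R r -> R.
Hypothesis se : forall j, exists theta q, separable a b theta q (e j).

Lemma G_discrete_update :
  G_discrete a b s X e = fun j => marginal_product s (empirical_mean X) (weight
    a b s e j).
Proof.
apply/funext => j; apply/funext => u; rewrite /G_discrete /marginal_product;
  congr (_ / _).
apply: eq_bigr => k _; rewrite /marginal /empirical_mean; apply: eq_bigr => i _.
by rewrite -[LHS]mulrA.
Qed.

Lemma descent_discrete e' : (0 < r)%N -> e' = G_discrete a b s X e ->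
  (\sum_(j < m) KL (e' j) (e j) <=
   objective_discrete a b s X e - objective_discrete a b s X e')%E.
Proof.
rewrite G_discrete_update => r_gt0 e'E.
have avg := averaging_empirical_mean n_gt0 X_in.
have se' j : exists theta q, separable a b theta q (e' j).
  by rewrite e'E; exact: (marginal_product_weight_separable kern avg).
apply: (le_trans (descent kern avg r_gt0 m_gt0 se e'E));
  rewrite /objective_discrete (integral_sum_separable se).
rewrite (integral_sum_separable se') -!EFinD lee_fin.
have -> : empirical_mean X (fun x => ln (Nsum a b s e' x) - ln (Nsum a b s e
  x)) =
    n%:R^-1 * (\sum_(i < n) ln (Nsum a b s e' (X i)))
    - n%:R^-1 * \sum_(i < n) ln (Nsum a b s e (X i)).
  by rewrite /empirical_mean -mulr_sumr sumrB mulrBr.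
have alg (x y z t : R) : y - x + (z - t) <= - x + z - (- y + t) by lra.
exact: alg.
Qed.

End discrete.
End instances.

Unset Implicit Arguments.

Theorem corollary3p3 (R : realType) (r m : nat) (a b h : R)
    (s : R -> R -> R -> R) (M1 : R -> R) (M2 B : R) (g : Rtuple R r -> R)
    (r_gt0 : (0 < r)%N) (a_lt_b : a < b)
    (g_target : target_density a b g) (g_mixture : sum_of_nonneg m g)
    (s_kernel : smoothing_kernel a b (s h) (M1 h) M2 B) :
  (forall e : nat -> 'I_m -> Rtuple R r -> R,
     candidate a b (M1 h) (e 0%N) ->
     (forall p, e p.+1 = G a b (s h) g (e p)) ->
     forall p,
       (objective a b (s h) g (e p) \is a fin_num ->
        \sum_(j < m) KL (e p.+1 j) (e p j)
          <= objective a b (s h) g (e p) - objective a b (s h) g (e p.+1))%E /\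
       (objective a b (s h) g (e p.+1) + \sum_(j < m) KL (e p.+1 j) (e p j)
          <= objective a b (s h) g (e p))%E) /\
  (forall (n : nat) (X : 'I_n -> Rtuple R r) (e : nat -> 'I_m -> Rtuple R r -> R),
     (0 < n)%N -> (forall i, Omega a b (X i)) ->
     candidate a b (M1 h) (e 0%N) ->
     (forall p, e p.+1 = G_discrete a b (s h) X (e p)) ->
     forall p,
       (\sum_(j < m) KL (e p.+1 j) (e p j)
          <= objective_discrete a b (s h) X (e p)
             - objective_discrete a b (s h) X (e p.+1))%E).
Proof.
(* Positivity of [Nsum] on [Omega] needs a component. For [m = 0] all families coincide, so the
   iteration is constant and both sums over [j] are empty. *)
have [m_gt0|] := ltnP 0 m; last first.
  rewrite leqn0 => /eqP m0; subst m.
  have e_eq (e e' : 'I_0 -> Rtuple R r -> R) : e = e' by apply/funext => -[].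
  split=> [e _ _ p|n X e _ _ _ _ p]; rewrite (e_eq (e p.+1) (e p)) big_ord0.
    by rewrite adde0; split => // ofin; rewrite subee.
  rewrite subee// /objective_discrete.
  under eq_integral do rewrite big_ord0.
  by rewrite integral0.
split=> [e ce eS p|n X e n_gt0 X_in ce eS p].
  apply: (descent_continuous s_kernel g_target _ _ _ (eS p)) => //.
  (* The candidate conditions are known only at step 0; separability is what propagates along the
     iteration. *)
  elim: p => [|p IH] j; first exact: (candidate_separable s_kernel).
  rewrite eS G_update.
  exact: (marginal_product_weight_separable s_kernel (averaging_target_mean
    s_kernel g_target)).
apply: (descent_discrete s_kernel _ _ _ _ _ (eS p)) => //.
elim: p => [|p IH] j; first exact: (candidate_separable s_kernel).
rewrite eS G_discrete_update.
exact: (marginal_product_weight_separable s_kernel (averaging_empirical_mean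
  s_kernel n_gt0 X_in)).
Qed.
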